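(* Let $k$ be an algebraically closed field of characteristic zero and let $\omega \in k$ be a root of unity of order $N > 1$. Then for all integers $n \ge 1$, $$\nu_n(T_{N^2}(\omega)) = d\sum_{i=0}^\infty \left\{ {N-1 \atop di,\, n-1} \right\}_{\omega}\, \omega^{-\check{n}di^2},$$ where $d = \gcd(N, n)$ and $\check{n}$ is an integer such that $\check{n}n \equiv d \pmod N$.
   Context: For a finite-dimensional Hopf algebra $H$ with antipode $S$ and $n \ge 1$, $\nu_n(H) = \mathrm{Tr}(S \circ P_H^{(n-1)}: H \to H) \in k$, where $P_H^{(m)}$ is the $m$-th convolution power of $\mathrm{id}_H$ ($P_H^{(0)}(h) = \varepsilon(h)1$, $P_H^{(m)}(h) = h_{(1)}\cdots h_{(m)}$ for $m \ge 1$). The Taft algebra $T_{N^2}(\omega)$ ($\omega$ a primitive $N$-th root of unity) is the Hopf algebra generated as an algebra by $x, g$ with relations $x^N = 0$, $g^N = 1$, $gx = \omega xg$, with $\Delta(x) = x\otimes1 + g\otimes x$, $\varepsilon(x) = 0$, $\Delta(g) = g\otimes g$, $\varepsilon(g) = 1$. For a formal parameter $q$, $(0)_q = 0$, $(n)_q = 1+q+\dots+q^{n-1}$ for $n\ge1$, $(0)_q! = 1$, $(n)_q! = (n-1)_q!\,(n)_q$, $\binom{m}{a}_q = \frac{(m)_q!}{(a)_q!\,(m-a)_q!}$ for $0\le a\le m$ and $\binom{m}{a}_q = 0$ otherwise (polynomials in $q$). For non-negative integers $L, a, m$, $$\left\{ {L \atop a,\, m} \right\}_{q} = \sum_{j_1+\dots+j_m=a}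 q^{j_1^2+\dots+j_m^2}\binom{L}{j_1}_q\binom{j_1}{j_2}_q\cdots\binom{j_{m-1}}{j_m}_q,$$ the sum over non-negative integers $j_1,\dots,j_m$ with $j_1+\dots+j_m = a$ (for $m=0$ this is $1$ if $a=0$ and $0$ otherwise); the subscript $\omega$ means substituting $q=\omega$ into this polynomial. It vanishes unless $0\le a\le mL$, so the infinite sum in the claim is finite. *)

(* Defs.v *)
From HB Require Import structures.
From mathcomp Require Import all_boot all_order all_algebra all_field.
From mathcomp Require Import classical_sets fsbigop.

Set Implicit Arguments.
Unset Strict Implicit.
Unset Printing Implicit Defensive.

Import GRing.Theory.
Local Open Scope ring_scope.

(* The tensor product of finite-dimensional spaces, as the matrices of        *)
(* coordinates with respect to the products of the library's default bases.   *)
(* tlift_pure and tensor_ext below state its universal property.              *)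
Section Tensor.
Variable k : fieldType.

Definition tensor (U V : vectType k) : vectType k :=
  'M[k]_(\dim {:U}, \dim {:V}).

Definition pure (U V : vectType k) (u : U) (v : V) : tensor U V :=
  \matrix_(i, j) (coord (vbasis {:U}) i u * coord (vbasis {:V}) j v).

(* The linear map that sends pure u v to B u v, for B bilinear. *)
Definition tlift (U V W : vectType k) (B : U -> V -> W) : 'Hom(tensor U V, W) :=
  linfun (fun t : tensor U V =>
    \sum_i \sum_j t i j *: B (vbasis {:U})`_i (vbasis {:V})`_j).

Definition tmap (U V U' V' : vectType k) (f : 'Hom(U, U')) (h : 'Hom(V, V')) :
    'Hom(tensor U V, tensor U' V') :=
  tlift (fun u v => pure (f u) (h v)).

Definition tassoc (U V W : vectType k) :
    'Hom(tensor (tensor U V) W, tensor U (tensor V W)) :=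
  tlift (fun t w => tlift (fun u v => pure u (pure v w)) t).

Definition tmul (A B : falgType k) (s t : tensor A B) : tensor A B :=
  tlift (fun a b => tlift (fun c d => pure (a * c) (b * d)) t) s.

End Tensor.

HB.mixin Record Falgebra_isHopf (k : fieldType) H of Falgebra k H := {
  comul : 'Hom(H, tensor H H);
  counit : 'Hom(H, k^o);
  antipode : 'End(H);
  comulA : forall h : H,
    tassoc H H H (tmap comul \1%VF (comul h)) = tmap \1%VF comul (comul h);
  counitl : forall h : H, tlift (fun a b : H => counit a *: b) (comul h) = h;
  counitr : forall h : H, tlift (fun a b : H => counit b *: a) (comul h) = h;
  comul1 : comul 1 = pure 1 1;
  comulM : forall a b : H, comul (a * b) = tmul (comul a) (comul b);
  counit1 : counit 1 = 1;
  counitM : forall a b : H, counit (a * b) = counit a * counit b;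
  antipodel : forall h : H,
    tlift (fun a b : H => antipode a * b) (comul h) = (counit h : k)%:A;
  antipoder : forall h : H,
    tlift (fun a b : H => a * antipode b) (comul h) = (counit h : k)%:A
}.

#[short(type="hopfAlgType")]
HB.structure Definition HopfAlgebra (k : fieldType) :=
  { H of Falgebra_isHopf k H & Falgebra k H }.

Section FrobeniusSchurIndicator.
Variables (k : fieldType) (H : hopfAlgType k).

Definition conv (f h : 'End(H)) : 'End(H) :=
  (tlift (fun a b : H => f a * h b) \o comul)%VF.

(* The neutral element of conv. *)
Definition conv_unit : 'End(H) := linfun (fun h : H => (counit h : k)%:A).

Definition hpower (m : nat) : 'End(H) := iter m (conv^~ \1%VF) conv_unit.

Definition lftrace (V : vectType k) (f : 'End(V)) : k :=
  \tr (passmx.mxof (vbasis {:V}) (vbasis {:V}) f).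

Definition nu (n : nat) : k := lftrace (antipode \o hpower n.-1)%VF.

End FrobeniusSchurIndicator.

Definition taft_relations (k : fieldType) (N : nat) (w : k) (A : algType k)
    (x g : A) : Prop :=
  [/\ x ^+ N = 0, g ^+ N = 1 & g * x = w *: (x * g)].

(* taft_gen and taft_free together say that H is the algebra presented by the *)
(* generators x, g and the relations taft_relations.                          *)
Record is_taft (k : fieldType) (N : nat) (w : k) (H : hopfAlgType k)
    (x g : H) : Prop := IsTaft {
  taft_rel : taft_relations N w x g;
  taft_gen : agenv <<[:: x; g]>>%VS = fullv;
  taft_free : forall (A : algType k) (x' g' : A), taft_relations N w x' g' ->
    exists f : {lrmorphism H -> A}, f x = x' /\ f g = g';
  taft_comulx : comul x = pure x 1 + pure g x;
  taft_counitx : counit x = 0;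
  taft_comulg : comul g = pure g g;
  taft_counitg : counit g = 1
}.

Section QBinomial.
Variable k : fieldType.

Definition qnat (n : nat) : {poly k} := \sum_(i < n) 'X^i.

Definition qfact (n : nat) : {poly k} := \prod_(i < n) qnat i.+1.

(* The division is exact: see qbinomE. *)
Definition qbinom (m a : nat) : {poly k} :=
  if (a <= m)%N then qfact m %/ (qfact a * qfact (m - a)) else 0.

(* Bounding the j_i by their sum a loses no term.  With j_0 = L, the entries  *)
(* of L :: map (@nat_of_ord _) j are j_0, j_1, ..., j_m.                      *)
Definition qcurly (L a m : nat) : {poly k} :=
  \sum_(j : m.-tuple 'I_a.+1 | (\sum_(i < m) tnth j i)%N == a)
    'X^(\sum_(i < m) tnth j i ^ 2)%N *
    \prod_(i < m) qbinom (nth 0%N (L :: map (@nat_of_ord _) j) i) (tnth j i).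

End QBinomial.

Section TensorTheory.
Variable k : fieldType.
Implicit Types U V W : vectType k.

Lemma tliftE U V W (B : U -> V -> W) (t : tensor U V) :
  tlift B t = \sum_i \sum_j t i j *: B (vbasis {:U})`_i (vbasis {:V})`_j.
Proof.
pose F (t : tensor U V) : W :=
  \sum_i \sum_j t i j *: B (vbasis {:U})`_i (vbasis {:V})`_j.
have linF : linear F.
  move=> c s s'; rewrite /F scaler_sumr -big_split; apply: eq_bigr => i _.
  rewrite scaler_sumr -big_split; apply: eq_bigr => j _.
  by rewrite !mxE scalerDl scalerA.
pose FM := GRing.isLinear.Build _ _ _ _ F linF.
pose FL : {linear _ -> _} := HB.pack F FM.
exact: (lfunE FL t).
Qed.

Lemma tlift_pure U V W (B : U -> V -> W) (u : U) (v : V) :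
    (forall u' : U, linear (B u')) -> (forall v' : V, linear (B^~ v')) ->
  tlift B (pure u v) = B u v.
Proof.
move=> linBr linBl; rewrite tliftE.
pose BrM u' := GRing.isLinear.Build _ _ _ _ (B u') (linBr u').
pose Br u' : {linear _ -> _} := HB.pack (B u') (BrM u').
pose BlM v' := GRing.isLinear.Build _ _ _ _ (B^~ v') (linBl v').
pose Bl v' : {linear _ -> _} := HB.pack (B^~ v') (BlM v').
rewrite [in RHS](coord_vbasis (memvf u)).
rewrite -[RHS]/(Bl v (\sum_i coord (vbasis {:U}) i u *: (vbasis {:U})`_i)).
rewrite linear_sum; apply: eq_bigr => i _; rewrite linearZ /=.
rewrite [in RHS](coord_vbasis (memvf v)).
rewrite -[B _ (\sum_j _)]/(Br (vbasis {:U})`_i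
  (\sum_j coord (vbasis {:V}) j v *: (vbasis {:V})`_j)).
rewrite linear_sum scaler_sumr; apply: eq_bigr => j _.
by rewrite linearZ /= !mxE scalerA.
Qed.

Lemma tensor_ext U V W (f h : 'Hom(tensor U V, W)) :
  (forall u v, f (pure u v) = h (pure u v)) -> f = h.
Proof.
have pureE (i : 'I_(\dim {:U})) (j : 'I_(\dim {:V})) :
    pure (vbasis {:U})`_i (vbasis {:V})`_j = delta_mx i j.
  apply/matrixP => i' j'.
  rewrite !mxE !coord_free ?(basis_free (vbasisP _)) //.
  by rewrite -natrM mulnb eq_sym [j == _]eq_sym.
move=> eqfh; apply/lfunP => t.
rewrite (matrix_sum_delta t) !linear_sum; apply: eq_bigr => i _.
rewrite !linear_sum; apply: eq_bigr => j _.
by rewrite !linearZ /= -pureE eqfh.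
Qed.

Lemma pure_linearl U V (v : V) : linear (fun u : U => pure u v).
Proof. by move=> c u u'; apply/matrixP=> i j; rewrite !mxE linearP /= mulrDl mulrA. Qed.

Lemma pure_linearr U V (u : U) : linear (fun v : V => pure u v).
Proof.
move=> c v v'; apply/matrixP=> i j.
by rewrite !mxE linearP /= mulrDr mulrCA.
Qed.

Lemma tlift_linear U V W W' (B : W' -> U -> V -> W) (t : tensor U V) :
    (forall u v, linear (fun w => B w u v)) ->
  linear (fun w => tlift (B w) t).
Proof.
move=> linB c w w'; rewrite !tliftE scaler_sumr -big_split.
apply: eq_bigr => i _; rewrite scaler_sumr -big_split.
by apply: eq_bigr => j _; rewrite /= linB scalerDr !scalerA mulrC.
Qed.

Lemma tmap_pure U V U' V' (f : 'Hom(U, U')) (h : 'Hom(V, V')) u v :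
  tmap f h (pure u v) = pure (f u) (h v).
Proof.
by rewrite tlift_pure // => w c a b; rewrite linearP ?pure_linearr ?pure_linearl.
Qed.

Lemma tassoc_pure U V W (u : U) (v : V) (w : W) :
  tassoc U V W (pure (pure u v) w) = pure u (pure v w).
Proof.
rewrite !tlift_pure //.
- by move=> u' c a b; rewrite pure_linearl pure_linearr.
- by move=> u' c a b; rewrite pure_linearl.
- move=> t; apply: tlift_linear => u' v' c a b.
  by rewrite !pure_linearr.
- by move=> w' c s t; rewrite linearP.
Qed.

Lemma tmul_pure (A B : falgType k) (a c : A) (b d : B) :
  tmul (pure a b) (pure c d) = pure (a * c) (b * d).
Proof.
have purel (u : B) (s t : A) e : pure (e *: s + t) u = e *: pure s u + pure t u.
  exact: pure_linearl.
have purer (u : A) (s t : B) e : pure u (e *: s + t) = e *: pure u s + pure u t.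
  exact: pure_linearr.
rewrite /tmul !tlift_pure //.
- by move=> a' e s t; rewrite mulrDr -scalerAr purer.
- by move=> b' e s t; rewrite mulrDr -scalerAr purel.
- move=> a'; apply: tlift_linear => c' d' e s t.
  by rewrite mulrDl -scalerAl purer.
- move=> b'; apply: tlift_linear => c' d' e s t.
  by rewrite mulrDl -scalerAl purel.
Qed.

End TensorTheory.

Section QBinomialTheory.
Variable k : fieldType.

Lemma qfactS n : qfact k n.+1 = qfact k n * qnat k n.+1.
Proof. by rewrite /qfact big_ord_recr. Qed.

Lemma qnat_neq0 n : qnat k n.+1 != 0.
Proof.
apply/eqP => /(congr1 (fun p : {poly k} => p`_0)).
rewrite /qnat coef_sum big_ord_recl big1 ?coefXn ?coef0 /= ?addr0 => [|i _].
  by move/eqP; rewrite oner_eq0.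
by rewrite coefXn.
Qed.

Lemma qfact_neq0 n : qfact k n != 0.
Proof. by rewrite /qfact; apply/prodf_neq0 => i _; apply: qnat_neq0. Qed.

Lemma qnatD m n : qnat k (m + n) = qnat k m + 'X^m * qnat k n.
Proof.
rewrite /qnat big_split_ord /= mulr_sumr; congr (_ + _).
by apply: eq_bigr => i _; rewrite -exprD.
Qed.

Lemma dvdp_qfact m a : (a <= m)%N ->
  (qfact k a * qfact k (m - a))%R %| qfact k m.
Proof.
elim: m a => [|m IHm] a.
  by rewrite leqn0 => /eqP->; rewrite /qfact !big_ord0 mulr1 dvdpp.
case: a => [|a] le_am; first by rewrite subn0 /qfact big_ord0 mul1r dvdpp.
rewrite subSS [qfact k m.+1]qfactS -[X in qnat k X](subnKC le_am) subSS.
rewrite qnatD mulrDr dvdp_add //.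
  rewrite qfactS -mulrA [qnat _ _ * _]mulrC mulrA.
  by rewrite dvdp_mul // IHm.
have [->|lt_am] := eqVneq a m.
  by rewrite subnn /qnat big_ord0 !mulr0 dvdp0.
have {}lt_am: (a < m)%N by rewrite ltn_neqAle lt_am.
rewrite -(subnSK lt_am) [qfact k (m - a.+1).+1]qfactS !mulrA.
by rewrite dvdp_mul // dvdp_mulr // IHm.
Qed.

Lemma qbinomE m a : (a <= m)%N ->
  qbinom k m a * (qfact k a * qfact k (m - a)) = qfact k m.
Proof. by move=> le_am; rewrite /qbinom le_am divpK ?dvdp_qfact. Qed.

(* So i |-> qcurly k L (d * i) m has finite support when 0 < d. *)
Lemma qcurly_eq0 L a m : (m * L < a)%N -> qcurly k L a m = 0.
Proof.
move=> lt_mL_a; rewrite /qcurly big1 // => j /eqP def_a.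
have [/forallP le_j | ] := boolP [forall i : 'I_m,
    (tnth j i <= nth 0%N (L :: map (@nat_of_ord _) j) i)%N]; last first.
  rewrite negb_forall => /existsP[i /negbTE gt_i].
  by rewrite [X in _ * X](bigD1 i) //= /qbinom gt_i mul0r mulr0.
suff le_jL i : (tnth j i <= L)%N.
  have: (\sum_(i < m) tnth j i <= \sum_(i < m) L)%N by apply: leq_sum => i _.
  by rewrite def_a sum_nat_const card_ord leqNgt lt_mL_a.
case: i => i; elim: i => [|i IHi] lt_im; first exact: (le_j (Ordinal lt_im)).
apply: leq_trans (le_j (Ordinal lt_im)) _ => /=.
have lt_im' := ltnW lt_im.
have := IHi lt_im'; rewrite (tnth_nth ord0) /=.
by rewrite (nth_map ord0) // size_tuple.
Qed.

End QBinomialTheory.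

(* Main.v *)
Require Import Defs.
From HB Require Import structures.
From mathcomp Require Import all_boot all_order all_algebra all_field.
From mathcomp Require Import classical_sets fsbigop.
From mathcomp Require Import ring zify.

Set Implicit Arguments.
Unset Strict Implicit.
Unset Printing Implicit Defensive.

Import GRing.Theory.
Local Open Scope ring_scope.

(* Let C_0(L) = [L = 0] and C_(m+1)(L) = sum_e binom(L, e)_w w^(e^2) X^e C_m(e).
   The coefficient of X^A in C_(m+1)(L) is the value at w of the symbol
   {L; A, m}: the last summation index of C_(m+1) is forced to be 0. The
   q-binomial theorem gives
     Delta(x^a g^b) = sum_e binom(a, e)_w x^(a-e) g^(e+b) (x) x^e g^b,
   whence, by induction on m,
     P^(m)(x^a g^b) = x^a g^(mb) C_m(a)(w^b g);
   it also gives, up to an explicit scalar, S(x^a g^c) = x^a g^(-a-c). The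
   trace is taken in the basis of the eigenvectors e_(a,s) of right
   multiplication by g in the span of the x^a g^b. As
   binom(N-1, a)_w w^(a^2) = (-1)^a w^(a(a-1)/2) is the scalar that comes from
   the antipode, the sum over a rebuilds C_n(N-1):
     nu_n = 1/N sum_(b,s mod N) w^(snb) C_n(N-1)(w^(b+s)).
   The sum over s selects, in the term of degree A, the b with nb = -A mod N.
   There are d of them if A = di, none if d does not divide A, and w^(bA)
   equals w^(-nc d i^2) at each of them. *)

(** * Gaussian binomial coefficients and their values at a primitive root of unity *)

Lemma qbinom0 (k : fieldType) m : qbinom k m 0 = 1.
Proof.
rewrite /qbinom leq0n subn0 [qfact k 0]big_ord0 mul1r.
by rewrite divpp ?qfact_neq0.
Qed.

Lemma qbinom_gt (k : fieldType) m a : (m < a)%N -> qbinom k m a = 0.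
Proof. by move=> lt_ma; rewrite /qbinom leqNgt lt_ma. Qed.

Lemma qbinomnn (k : fieldType) m : qbinom k m m = 1.
Proof.
rewrite /qbinom leqnn subnn [qfact k 0]big_ord0 mulr1.
by rewrite divpp ?qfact_neq0.
Qed.

Lemma qbinom_sub (k : fieldType) m a : (a <= m)%N ->
  qbinom k m (m - a) = qbinom k m a.
Proof.
by move=> le_am; rewrite /qbinom leq_subr le_am subKn // [qfact k a * _]mulrC.
Qed.

(** After multiplication by (a+1)_q! (m-a)_q! this is (m+1)_q = (m-a)_q + q^(m-a) (a+1)_q, times
    (m)_q!. *)
Lemma qbinomS (k : fieldType) m a : (a <= m)%N ->
  qbinom k m.+1 a.+1 = qbinom k m a.+1 + 'X^(m - a) * qbinom k m a.
Proof.
move=> le_am; have nz b : qfact k b != 0 by exact: qfact_neq0.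
have [-> | ne_am] := eqVneq a m.
  by rewrite !qbinomnn qbinom_gt // subnn add0r mulr1.
have lt_am : (a < m)%N by rewrite ltn_neqAle ne_am.
have [e def_m] : {e | (m - a = e.+1)%N}.
  by exists (m - a).-1; rewrite prednK ?subn_gt0.
have def_e : (m - a.+1 = e)%N by rewrite subnS def_m.
have defSm : (m.+1 = e.+1 + a.+1)%N by rewrite -def_m addnS subnK.
have Em : (qfact k m.+1 = qbinom k m.+1 a.+1 * (qfact k a.+1 * qfact k e.+1)).
  by rewrite -def_m -subSS qbinomE.
apply: (mulIf (mulf_neq0 (nz a.+1) (nz e.+1))).
rewrite -Em qfactS defSm qnatD def_m mulrDr mulrDl.
rewrite -{1}(qbinomE k lt_am) -{1}(qbinomE k le_am) def_m def_e !qfactS.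
by congr (_ + _); ring.
Qed.

(** For a < m this is [qbinomS] read through the symmetry [qbinom_sub]. *)
Lemma qbinomS' (k : fieldType) m a :
  qbinom k m.+1 a.+1 = 'X^(a.+1) * qbinom k m a.+1 + qbinom k m a.
Proof.
have [lt_am | le_ma] := ltnP a m; last first.
  rewrite [qbinom k m a.+1]qbinom_gt ?ltnS // mulr0 add0r.
  move: le_ma; rewrite leq_eqVlt => /predU1P[-> | lt_ma].
    by rewrite !qbinomnn.
  by rewrite !qbinom_gt.
rewrite -qbinom_sub ?(ltnW lt_am) // ?ltnS 1?ltnW // subSS -(subnSK lt_am).
rewrite qbinomS ?leq_subr // subKn // subnSK // addrC.
by rewrite !qbinom_sub // ltnW.
Qed.

(** By [qbinomS'] the sum telescopes. At r = m + 1 the right side is 0, which is the relation that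
    determines the antipode. *)
Lemma sum_qbinom_sign (k : fieldType) m r :
  \sum_(f < r.+1) (-1) ^+ f * 'X^('C(f, 2)) * qbinom k m.+1 f =
  (-1) ^+ r * 'X^('C(r.+1, 2)) * qbinom k m r.
Proof.
elim: r => [|r IHr]; first by rewrite big_ord1 !qbinom0.
rewrite big_ord_recr /= IHr qbinomS' [in RHS]binS bin1.
by rewrite exprS exprD; ring.
Qed.

Lemma horner_qnat (k : fieldType) (z : k) m :
  (qnat k m).[z] = \sum_(i < m) z ^+ i.
Proof. by rewrite horner_sum; apply: eq_bigr => i _; rewrite hornerXn. Qed.

Lemma horner_qfact_neq0 (k : fieldType) (z : k) N m :
  N.-primitive_root z -> (m < N)%N -> (qfact k m).[z] != 0.
Proof.
move=> z_prim lt_mN; rewrite horner_prod; apply/prodf_neq0 => i _.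
rewrite horner_qnat; apply/eqP => sum0.
have := subrX1 z i.+1; rewrite sum0 mulr0 => /eqP.
rewrite subr_eq0 -(prim_order_dvd z_prim) => /dvdn_leq -/(_ isT).
by rewrite leqNgt (leq_ltn_trans (ltn_ord i)).
Qed.

(** The numerator (N)_z! has the factor (N)_z = 0, while the factorials in the denominator do not
    vanish at z. *)
Lemma horner_qbinom_prim_root (k : fieldType) (z : k) N f :
    N.-primitive_root z -> (1 < N)%N -> (0 < f < N)%N ->
  (qbinom k N f).[z] = 0.
Proof.
move=> z_prim N_gt1 /andP[f_gt0 lt_fN].
have := congr1 (horner^~ z) (qbinomE k (ltnW lt_fN)); rewrite !hornerM.
have -> : (qfact k N).[z] = 0.
  rewrite -(ltn_predK N_gt1) qfactS hornerM horner_qnat (ltn_predK N_gt1).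
  have z_neq1 : z - 1 != 0.
    by rewrite subr_eq0 -[z]expr1 -(prim_order_dvd z_prim) dvdn1 gtn_eqF.
  have /esym/eqP := subrX1 z N; rewrite (prim_expr_order z_prim) subrr.
  by rewrite mulf_eq0 (negbTE z_neq1) => /eqP ->; rewrite mulr0.
move/eqP; rewrite !mulf_eq0 => /or3P[/eqP-> // | |].
  by rewrite (negbTE (horner_qfact_neq0 z_prim lt_fN)).
by rewrite (negbTE (horner_qfact_neq0 z_prim _)) // ltn_subrL f_gt0 ltnW.
Qed.

(** As binom(N, f+1)_z = 0, Pascal's rule becomes binom(N-1, f+1)_z = - z^(-(f+1)) binom(N-1, f)_z.
    The factor z^(f^2) then turns the exponent -f(f+1)/2 into f(f-1)/2. *)
Lemma horner_qbinom_pred (k : fieldType) (z : k) N f :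
    N.-primitive_root z -> (1 < N)%N -> (f < N)%N ->
  (qbinom k N.-1 f).[z] * z ^+ (f ^ 2) = (-1) ^+ f * z ^+ 'C(f, 2).
Proof.
move=> z_prim N_gt1; elim: f => [|f IHf] lt_fN.
  by rewrite qbinom0 hornerC !expr0.
have le_fN : (f <= N.-1)%N by lia.
have := congr1 (horner^~ z) (qbinomS k le_fN).
rewrite (ltn_predK N_gt1) (horner_qbinom_prim_root z_prim) //.
rewrite hornerD hornerM hornerXn => /eqP; rewrite eq_sym addr_eq0 => /eqP ->.
have -> : (f.+1 ^ 2 = f ^ 2 + f + f.+1)%N by lia.
rewrite binS bin1 exprS [z ^+ ('C(f, 2) + f)]exprD.
transitivity (- z ^+ f * ((-1) ^+ f * z ^+ 'C(f, 2))); last by ring.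
rewrite -IHf 1?ltnW // -[RHS]mulr1 -(prim_expr_order z_prim).
have -> : (N.-1 - f = N - f.+1)%N by lia.
by rewrite -[in z ^+ N](subnK (ltnW lt_fN)) !exprD; ring.
Qed.

(** * Convolution of endomorphisms of a Hopf algebra, and traces *)

Lemma linfunE (k : fieldType) (U V : vectType k) (f : U -> V) :
  linear f -> linfun f =1 f.
Proof.
move=> linf u; pose FM := GRing.isLinear.Build _ _ _ _ f linf.
by pose F : {linear _ -> _} := HB.pack f FM; apply: (lfunE F).
Qed.

Lemma tensor3_ext (k : fieldType) (U V W X : vectType k)
    (f h : 'Hom(tensor (tensor U V) W, X)) :
    (forall u v w, f (pure (pure u v) w) = h (pure (pure u v) w)) ->
  f = h.
Proof.
move=> eqfh; apply: tensor_ext => t w.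
pose L : 'Hom(tensor U V, tensor (tensor U V) W) := linfun (fun s => pure s w).
have LE s : L s = pure s w by rewrite linfunE //; apply: pure_linearl.
suff /lfunP/(_ t) : (f \o L = h \o L)%VF by rewrite !comp_lfunE LE.
by apply: tensor_ext => u v; rewrite !comp_lfunE LE.
Qed.

Section Convolution.
Variables (k : fieldType) (H : hopfAlgType k).
Implicit Types f h : 'End(H).

(** The domains are arbitrary so that the construction can be nested on iterated tensor products. *)
Definition lmul_tensor (U V : vectType k) (f : 'Hom(U, H)) (h : 'Hom(V, H)) :
    'Hom(tensor U V, H) :=
  tlift (fun u v => f u * h v).

Lemma lmul_tensor_pure (U V : vectType k) (f : 'Hom(U, H)) (h : 'Hom(V, H))
    (u : U) (v : V) :
  lmul_tensor f h (pure u v) = f u * h v.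
Proof.
rewrite /lmul_tensor tlift_pure // => [u' | v'] c a b; rewrite linearP.
  by rewrite mulrDr -scalerAr.
by rewrite mulrDl -scalerAl.
Qed.

Lemma convE f h : conv f h = (lmul_tensor f h \o comul)%VF.
Proof. by []. Qed.

(** Each side is the same threefold product [G], composed with one of the two iterated coproducts;
    [comulA] identifies these. *)
Lemma convA f g h : conv f (conv g h) = conv (conv f g) h.
Proof.
pose G : 'Hom(tensor H (tensor H H), H) := lmul_tensor f (lmul_tensor g h).
have -> : conv f (conv g h) = (G \o (tmap \1 comul \o comul))%VF.
  rewrite comp_lfunA [LHS]convE; congr (_ \o _)%VF; apply: tensor_ext => u v.
  by rewrite comp_lfunE tmap_pure !lmul_tensor_pure convE !comp_lfunE id_lfunE.
have -> : conv (conv f g) h =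
    (G \o (tassoc H H H \o (tmap comul \1 \o comul)))%VF.
  rewrite !comp_lfunA [LHS]convE; congr (_ \o _)%VF.
  have -> : (G \o tassoc H H H)%VF = lmul_tensor (lmul_tensor f g) h.
    apply: tensor3_ext => u v w.
    by rewrite comp_lfunE tassoc_pure !lmul_tensor_pure mulrA.
  apply: tensor_ext => u v.
  by rewrite comp_lfunE tmap_pure !lmul_tensor_pure convE !comp_lfunE id_lfunE.
by congr (_ \o _)%VF; apply/lfunP => a; rewrite !comp_lfunE -comulA.
Qed.

Lemma conv_unitE a : conv_unit H a = (counit a : k)%:A.
Proof.
by rewrite linfunE // => c u v; rewrite linearP /= scalerDl scalerA.
Qed.

Lemma conv1f h : conv (conv_unit H) h = h.
Proof.
apply/lfunP => a; rewrite convE comp_lfunE /= -[in RHS](counitl a).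
rewrite -[RHS]comp_lfunE.
congr (fun_of_lfun _ _); apply: tensor_ext => u v.
rewrite lmul_tensor_pure conv_unitE comp_lfunE tlift_pure.
- by rewrite linearZ /= -scalerAl mul1r.
- by move=> u' c x y; rewrite scalerDr scalerA mulrC -scalerA.
- by move=> v' c x y; rewrite linearP /= scalerDl scalerA.
Qed.

Lemma convf1 h : conv h (conv_unit H) = h.
Proof.
apply/lfunP => a; rewrite convE comp_lfunE /= -[in RHS](counitr a).
rewrite -[RHS]comp_lfunE.
congr (fun_of_lfun _ _); apply: tensor_ext => u v.
rewrite lmul_tensor_pure conv_unitE comp_lfunE tlift_pure.
- by rewrite linearZ /= -scalerAr mulr1.
- by move=> u' c x y; rewrite linearP /= scalerDl scalerA.
- by move=> v' c x y; rewrite scalerDr scalerA mulrC -scalerA.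
Qed.

(** With the new factor on the left, the induction in [taft_hpower] acts on the second tensor
    factors x^e g^b of the coproduct, where b stays fixed. *)
Lemma hpowerSr m : hpower H m.+1 = conv \1%VF (hpower H m).
Proof.
rewrite /hpower; elim: m => [|m IHm]; first by rewrite /= conv1f convf1.
by rewrite iterS {1}IHm -convA.
Qed.

End Convolution.

(* The forms chi and the vectors e need not be dual to each other. *)
Lemma lftrace_expansion (k : fieldType) (V : vectType k) (I : finType)
    (chi : I -> 'Hom(V, k^o)) (e : I -> V) (f : 'End(V)) :
    (forall v, v = \sum_i chi i v *: e i) ->
  lftrace f = \sum_i chi i (f (e i)).
Proof.
move=> expV; pose b := vbasis {:V}.
transitivity (\sum_j coord b j (f b`_j)).
  apply: eq_bigr => j _; rewrite !mxE /= /passmx.vecof (bigD1 j) //=.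
  rewrite !mxE !eqxx scale1r big1 ?addr0 // => l /negbTE ne_lj.
  by rewrite mxE ne_lj andbF scale0r.
(* Each value of [f] on a basis vector is expanded in the vectors [e i]; once the sums are
   exchanged, [e i] is rebuilt from its coordinates. *)
rewrite (eq_bigr (fun j : 'I_(\dim {:V}) =>
    \sum_i chi i (f b`_j) * coord b j (e i))); last first.
  move=> j _; rewrite {1}(expV (f b`_j)) linear_sum.
  by apply: eq_bigr => i _; rewrite linearZ.
rewrite exchange_big; apply: eq_bigr => i _.
rewrite [in RHS](coord_vbasis (memvf (e i))) !linear_sum.
by apply: eq_bigr => j _; rewrite !linearZ /= mulrC.
Qed.

(** * The symbols {L; a, m} at w as coefficients of recursively defined polynomials *)

Lemma sum_ord_widen (R : nmodType) m n (F : nat -> R) :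
    (forall i, (m <= i)%N -> F i = 0) -> (m <= n)%N ->
  \sum_(i < n) F i = \sum_(i < m) F i.
Proof.
move=> F0 le_mn; rewrite (big_ord_widen_cond n xpredT F le_mn).
rewrite [RHS]big_mkcond /=.
by apply: eq_bigr => i _; case: ltnP => // /F0.
Qed.

Lemma sum_tupleS (R : nmodType) (T : finType) m (P : pred (m.+1.-tuple T))
    (F : m.+1.-tuple T -> R) :
  \sum_(t | P t) F t =
  \sum_(i : T) \sum_(t : m.-tuple T | P (cons_tuple i t)) F (cons_tuple i t).
Proof.
rewrite pair_big_dep /=.
rewrite (reindex (fun p : T * m.-tuple T => cons_tuple p.1 p.2)) //=.
exists (fun t => (thead t, behead_tuple t)) => [[i t] _ | t _] /=.
  by congr (_, _); apply: val_inj.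
by rewrite [RHS]tuple_eta; apply: val_inj.
Qed.

(** This is C_m(L), with q already specialised to w; each step of the recursion peels off the
    outermost index. *)
Fixpoint curlyp (k : fieldType) (w : k) (m L : nat) : {poly k} :=
  if m is m'.+1 then
    \sum_(e < L.+1)
      ((qbinom k L e).[w] * w ^+ (e ^ 2)) *: ('X^e * curlyp w m' e)
  else (L == 0%N)%:R.

(** The bound [B] is kept apart from [a] because the induction passes from [a] to [a - e], while the
    index type of the tuples must not change. *)
Lemma coef_curlyp_tuple (k : fieldType) (w : k) B m L a : (a <= B)%N ->
  (curlyp w m.+1 L)`_a =
  \sum_(j : m.-tuple 'I_B.+1 | (\sum_(i < m) tnth j i)%N == a)
    w ^+ (\sum_(i < m) tnth j i ^ 2)%N *
    \prod_(i < m)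
      (qbinom k (nth 0%N (L :: map (@nat_of_ord _) j) i) (tnth j i)).[w].
Proof.
elim: m L a => [|m IHm] L a le_aB.
  rewrite /= big_ord_recl big1 => [|e _]; last by rewrite mulr0 scaler0.
  rewrite qbinom0 hornerC !expr0 !mulr1 scale1r addr0 coef1.
  rewrite big_mkcond (big_pred1 [tuple]) => [| t]; last exact/esym/eqP/tuple0.
  by rewrite !big_ord0 eq_sym; case: eqP; rewrite ?expr0 ?mul1r.
pose F e := (qbinom k L e).[w] * w ^+ (e ^ 2) *
  (if (a < e)%N then 0 else (curlyp w m.+1 e)`_(a - e)).
have -> : (curlyp w m.+2 L)`_a = \sum_(e < L.+1) F e.
  rewrite [curlyp _ _ _]/= coef_sum; apply: eq_bigr => e _.
  by rewrite coefZ coefXnM.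
(* The recursion lets e run up to [L], the tuples up to [B]. Beyond [L] the binomial vanishes, and
   beyond [B] one has e > a. *)
transitivity (\sum_(e < B.+1) F e).
  have F0 e : (L < e)%N || (B < e)%N -> F e = 0.
    case/orP => [lt_Le | lt_Be].
      by rewrite /F qbinom_gt // hornerC !mul0r.
    by rewrite /F (leq_ltn_trans le_aB) // mulr0.
  have [le_LB | /ltnW le_BL] := leqP L B.
    by apply/esym/sum_ord_widen => // i lt_Li; rewrite F0 ?lt_Li.
  by apply: sum_ord_widen => // i lt_Bi; rewrite F0 ?lt_Bi ?orbT.
rewrite sum_tupleS; apply: eq_bigr => e _; rewrite /F.
case: ltnP => [lt_ae | le_ea].
  rewrite mulr0 big1 // => t; rewrite big_ord_recl tnth0 => /eqP def_a.
  by move: lt_ae; rewrite -def_a ltnNge leq_addr.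
rewrite (IHm e (a - e)%N) ?(leq_trans (leq_subr _ _)) // mulr_sumr.
apply: eq_big => [t | t _].
  rewrite big_ord_recl tnth0 -(eqn_add2l e) subnKC //.
  by under [in RHS]eq_bigr do rewrite tnthS.
rewrite !big_ord_recl tnth0 /= exprD.
under [in RHS]eq_bigr do rewrite tnthS.
under [X in _ = _ * (_ * X)]eq_bigr do rewrite tnthS.
by ring.
Qed.

Lemma coef_curlyp (k : fieldType) (w : k) m L a :
  (curlyp w m.+1 L)`_a = (qcurly k L a m).[w].
Proof.
rewrite (coef_curlyp_tuple w _ _ (leqnn a)) horner_sum; apply: eq_bigr => j _.
by rewrite hornerM hornerXn horner_prod.
Qed.

(** * Sums of powers of a primitive root of unity, and linear congruences *)

Lemma sum_prim_root_exp (k : fieldType) (w : k) N t : N.-primitive_root w ->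
  \sum_(s < N) w ^+ (s * t) = N%:R * (N %| t)%:R.
Proof.
move=> w_prim; under eq_bigr do rewrite mulnC exprM.
have [N_dvd_t | N_ndvd_t] := boolP (N %| t)%N.
  have -> : w ^+ t = 1 by apply/eqP; rewrite -(prim_order_dvd w_prim).
  under eq_bigr do rewrite expr1n.
  by rewrite sumr_const card_ord mulr1.
rewrite mulr0; have /esym/eqP := subrX1 (w ^+ t) N.
rewrite -exprM mulnC exprM (prim_expr_order w_prim) expr1n subrr mulf_eq0.
by rewrite subr_eq0 -(prim_order_dvd w_prim) (negbTE N_ndvd_t) => /eqP.
Qed.

Lemma dvdn_gcdr_mul N n s : (N %| s * n)%N = (N %| s * gcdn N n)%N.
Proof. by rewrite muln_gcdr dvdn_gcd (dvdn_mull s (dvdnn N)). Qed.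

(** By [dvdn_gcdr_mul] the solutions are the multiples of M = N / gcd(N, n), and gcd(N, n) of them
    lie below N. *)
Lemma card_dvdn_mul N n : (0 < N)%N ->
  (\sum_(s < N) (N %| s * n) = gcdn N n)%N.
Proof.
move=> N_gt0; have d_gt0 : (0 < gcdn N n)%N by rewrite gcdn_gt0 N_gt0.
pose M := (N %/ gcdn N n)%N.
have def_N : (M * gcdn N n = N)%N by rewrite divnK ?dvdn_gcdl.
have M_gt0 : (0 < M)%N by rewrite divn_gt0 // dvdn_leq // dvdn_gcdl.
transitivity (\sum_(s < N) (M %| s))%N.
  apply: eq_bigr => s _.
  by rewrite dvdn_gcdr_mul -[X in (X %| _)%N]def_N dvdn_pmul2r.
(* [divn_count_dvd] counts multiples among 1, ..., N instead of 0, ..., N-1; the end terms at 0 and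
   N are both 1. *)
rewrite -(mulKn (gcdn N n) M_gt0) def_N divn_count_dvd.
rewrite -(big_mkord xpredT (fun s => nat_of_bool (M %| s)%N)) big_ltn //.
rewrite big_nat_recr //= dvdn0 addnC; congr (_ + _)%N.
by rewrite -def_N dvdn_mulr.
Qed.

Lemma prim_exprz_eq1 (k : fieldType) (w : k) N (z : int) :
  N.-primitive_root w -> (N %| z)%Z -> w ^ z = 1.
Proof.
move=> w_prim /dvdzP[y ->]; rewrite mulrC -exprz_exp -exprnP.
by rewrite (prim_expr_order w_prim) exp1rz.
Qed.

Section GaussSum.
Variables (k : fieldType) (w : k) (N n : nat) (nc : int).
Hypotheses (char0 : [pchar k] =i pred0) (w_prim : N.-primitive_root w).
Hypothesis ncP : (nc * n = gcdn N n %[mod N])%Z.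

Let d := gcdn N n.
Let N_gt0 : (0 < N)%N := prim_order_gt0 w_prim.
Let N_neq0 : N%:R != 0 :> k.
Proof. by rewrite ((pcharf0P k).1 char0) -lt0n. Qed.

(** The divisibility is detected by the sum over s of w^(s(nb + di)). Summing over b first leaves
    the s with N | sn; these satisfy N | sd, so w^(sdi) = 1, and [card_dvdn_mul] counts them. *)
Lemma sum_dvdn_linear i :
  \sum_(b < N) (N %| n * b + d * i)%:R = d%:R :> k.
Proof.
apply: (mulfI N_neq0).
transitivity (\sum_(s < N) w ^+ (s * (d * i)) * (N%:R * (N %| s * n)%:R)).
  under [RHS]eq_bigr => s _ do rewrite -(sum_prim_root_exp _ w_prim) mulr_sumr.
  rewrite exchange_big mulr_sumr; apply: eq_bigr => b _.
  rewrite -(sum_prim_root_exp _ w_prim); apply: eq_bigr => s _.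
  by rewrite -exprD; congr (_ ^+ _); lia.
rewrite -[d in RHS](card_dvdn_mul n N_gt0) natr_sum mulr_sumr.
apply: eq_bigr => s _.
have [N_dvd | ] := boolP (N %| s * n)%N; last by rewrite !mulr0.
suff -> : w ^+ (s * (d * i)) = 1 by rewrite mul1r.
apply/eqP; rewrite -(prim_order_dvd w_prim) mulnA dvdn_mulr //.
by rewrite -dvdn_gcdr_mul.
Qed.

(** If A = di and nb = -di mod N, then bdi = nc n b i = -nc d i^2 mod N, so every solution b
    contributes the same power of w. *)
Lemma sum_expr_dvdn_linear A :
  \sum_(b < N) (N %| n * b + A)%:R * w ^+ (b * A) =
  if (d %| A)%N then d%:R * w ^ (- (nc * (d * (A %/ d) ^ 2)%N%:Z)) else 0.
Proof.
case: ifPn => [/dvdnP[i ->{A}] | d_ndvd_A]; last first.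
  apply: big1 => b _; rewrite (_ : (N %| _)%N = false) ?mul0r //.
  apply: contraNF d_ndvd_A => /(dvdn_trans (dvdn_gcdl N n)).
  by rewrite dvdn_addr // dvdn_mulr // dvdn_gcdr.
have d_gt0 : (0 < d)%N by rewrite gcdn_gt0 N_gt0.
rewrite mulnK // mulnC -(sum_dvdn_linear i) mulr_suml; apply: eq_bigr => b _.
have [N_dvd | ] := boolP (N %| _)%N; last by rewrite !mul0r.
rewrite !mul1r.
have w_neq0 : w != 0.
  by apply/eqP => w0; have /eqP := prim_expr_order w_prim;
    rewrite w0 expr0n gtn_eqF // eq_sym oner_eq0.
apply: (mulIf (expfz_neq0 (nc * (d * i ^ 2)%N%:Z) w_neq0)).
rewrite -[RHS]expfzDr // addNr expr0z exprnP -expfzDr //.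
apply: (prim_exprz_eq1 w_prim).
have /dvdzP[u Eu] : (N %| (nc * n%:Z - d%:Z)%R)%Z.
  by rewrite -eqz_mod_dvd; apply/eqP.
have /dvdnP[t Et] := N_dvd.
(* With nc n - d = uN and nb + di = tN, the exponent bdi + nc d i^2 equals nc i (tN) - (uN) b i. *)
apply/dvdzP; exists (nc * i * t%:Z - u * b%:Z * i%:Z)%R.
have {Et}: (n * b + d * i)%:Z = (t * N)%:Z by rewrite Et.
rewrite -mulnn !PoszM PoszD !PoszM => Et.
rewrite mulrBl -[X in _ = X - _]mulrA -Et.
transitivity (nc * i * (n * b + d * i) - (u * N) * b * i)%R; last by ring.
by rewrite -Eu; ring.
Qed.

Lemma sum_horner_prim_root (p : {poly k}) :
  N%:R^-1 * \sum_(b < N) \sum_(s < N) w ^+ (s * (n * b)) * p.[w ^+ (b + s)] =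
  d%:R * \sum_(i \in [set: nat]%classic)
    p`_(d * i) * w ^ (- (nc * (d * i ^ 2)%N%:Z)).
Proof.
have d_gt0 : (0 < d)%N by rewrite gcdn_gt0 N_gt0.
transitivity (\sum_(A < size p)
    p`_A * \sum_(b < N) (N %| n * b + A)%:R * w ^+ (b * A)).
  rewrite mulr_sumr.
  transitivity (\sum_(b < N) \sum_(A < size p)
     p`_A * ((N %| n * b + A)%:R * w ^+ (b * A))); last first.
    by rewrite exchange_big; apply: eq_bigr => A _; rewrite mulr_sumr.
  apply: eq_bigr => b _; under eq_bigr do rewrite horner_coef mulr_sumr.
  rewrite exchange_big mulr_sumr; apply: eq_bigr => A _.
  apply: (mulfI N_neq0); rewrite mulVKf // [RHS]mulrCA [N%:R * (_ * _)]mulrA.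
  rewrite -(sum_prim_root_exp _ w_prim) mulr_suml mulr_sumr.
  apply: eq_bigr => s _; rewrite -exprM [LHS]mulrCA -!exprD.
  by congr (_ * _ ^+ _); lia.
under eq_bigr do rewrite sum_expr_dvdn_linear.
pose F i := w ^ (- (nc * (d * i ^ 2)%N%:Z)).
(* As i <= di, the coefficients vanish from [size p] on, and the infinite sum can be cut there. *)
rewrite (fsbigE (index_iota 0 (size p))) ?iota_uniq //; last first.
  move=> i _; rewrite mem_index_iota -leqNgt /= => le_pi.
  by rewrite nth_default ?mul0r // (leq_trans le_pi) // leq_pmull.
rewrite [in RHS](eq_bigl xpredT) => [|i]; last by rewrite mem_set.
rewrite big_mkord mulr_sumr.
(* Both sides become one sum over the pairs with A = di; since d > 0, either member of a pair
   determines the other. *)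
transitivity (\sum_(A < size p) \sum_(i < size p)
    if A == (d * i)%N :> nat then d%:R * (p`_A * F i) else 0).
  apply: eq_bigr => A _; rewrite -big_mkcond /=.
  case: ifPn => [/dvdnP[i def_A] | d_ndvd_A]; last first.
    rewrite mulr0 big1 // => i /eqP def_A.
    by rewrite def_A dvdn_mulr in d_ndvd_A.
  have lt_ip : (i < size p)%N.
    by apply: leq_ltn_trans (ltn_ord A); rewrite def_A leq_pmulr.
  rewrite (big_pred1 (Ordinal lt_ip)) => [|j] /=.
    by rewrite {2}def_A mulnK // mulrCA.
  by rewrite def_A mulnC eqn_pmul2l // eq_sym.
rewrite exchange_big; apply: eq_bigr => i _; rewrite -big_mkcond /=.
have [lt_dip | le_pdi] := ltnP (d * i)%N (size p).
  by rewrite (big_pred1 (Ordinal lt_dip)).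
rewrite nth_default // mul0r mulr0 big1 // => A /eqP def_A.
by move: le_pdi; rewrite -def_A leqNgt ltn_ord.
Qed.
End GaussSum.

(** * The Hopf structure of the Taft algebra on the monomials x^a g^b *)

Lemma tmul_linearr (k : fieldType) (A B : falgType k) (s : tensor A B) :
  linear (tmul s).
Proof.
pose T t' (a : A) (b : B) : tensor A B :=
  tlift (fun c d => pure (a * c) (b * d)) t'.
by apply: (@tlift_linear _ _ _ _ _ T s) => a b c t t'; apply: linearP.
Qed.

Lemma tmulDl (k : fieldType) (A B : falgType k) (s s' t : tensor A B) :
  tmul (s + s') t = tmul s t + tmul s' t.
Proof. by rewrite /tmul linearD. Qed.

Lemma pureZl (k : fieldType) (U V : vectType k) c (u : U) (v : V) :
  pure (c *: u) v = c *: pure u v.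
Proof. by apply/matrixP => i j; rewrite !mxE linearZ /= mulrA. Qed.

Lemma conv_antipodel (k : fieldType) (H : hopfAlgType k) (a : H) :
  conv antipode \1%VF a = (counit a : k)%:A.
Proof.
rewrite -antipodel comp_lfunE !tliftE; apply: eq_bigr => i _.
by apply: eq_bigr => j _; rewrite id_lfunE.
Qed.

Section TaftAlgebra.
Variables (k : fieldType) (N : nat) (w : k) (H : hopfAlgType k) (x g : H).
Hypothesis taftH : is_taft N w x g.

Let xN : x ^+ N = 0. Proof. by case: taftH => -[]. Qed.
Let gN : g ^+ N = 1. Proof. by case: taftH => -[]. Qed.
Let gx : g * x = w *: (x * g). Proof. by case: taftH => -[]. Qed.

Lemma taft_comm a b : g ^+ b * x ^+ a = w ^+ (b * a) *: (x ^+ a * g ^+ b).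
Proof.
have gx1 c : g * x ^+ c = w ^+ c *: (x ^+ c * g).
  elim: c => [|c IHc]; first by rewrite mul1r mulr1 scale1r.
  rewrite [in LHS]exprSr mulrA IHc -scalerAl -mulrA gx -scalerAr scalerA mulrA.
  by rewrite -!exprSr.
elim: b => [|b IHb]; first by rewrite mul1r mulr1 scale1r.
rewrite [in LHS]exprS -mulrA IHb -scalerAr mulrA gx1 -scalerAl scalerA -mulrA.
by rewrite -exprS -exprD mulSn addnC.
Qed.

Lemma taft_comulXg b : comul (g ^+ b) = pure (g ^+ b) (g ^+ b).
Proof.
elim: b => [|b IHb]; first by rewrite comul1.
by rewrite exprS comulM IHb (taft_comulg taftH) tmul_pure.
Qed.

(** Left multiplication by Delta(x) sends term e to terms e and e + 1, the latter with the factor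
    w^(a-e) from moving g past x^(a-e); [qbinomS] collects the coefficients. *)
Lemma taft_comul a b :
  comul (x ^+ a * g ^+ b) =
  \sum_(e < a.+1) (qbinom k a e).[w] *:
    pure (x ^+ (a - e) * g ^+ (e + b)) (x ^+ e * g ^+ b).
Proof.
elim: a => [|a IHa].
  by rewrite big_ord1 qbinom0 hornerC scale1r mul1r taft_comulXg.
pose P e := pure (x ^+ (a.+1 - e) * g ^+ (e + b)) (x ^+ e * g ^+ b).
have comulP e : (e <= a)%N ->
    tmul (pure x 1 + pure g x)
      (pure (x ^+ (a - e) * g ^+ (e + b)) (x ^+ e * g ^+ b)) =
    P e + w ^+ (a - e) *: P e.+1.
  move=> le_ea; rewrite tmulDl !tmul_pure mul1r mulrA.
  have := taft_comm (a - e) 1; rewrite !expr1 mul1n => gxa.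
  rewrite -exprS -subSn // [x * _]mulrA -exprS -/(P e); congr (_ + _).
  by rewrite mulrA gxa -scalerAl pureZl -mulrA -!exprS.
rewrite exprS -mulrA comulM IHa (taft_comulx taftH).
pose LM s := GRing.isLinear.Build _ _ _ _ (tmul s) (@tmul_linearr k H H s).
pose L s : {linear tensor H H -> tensor H H} := HB.pack (tmul s) (LM s).
rewrite -[LHS]/(L _ _) linear_sum.
transitivity (\sum_(e < a.+1) ((qbinom k a e).[w] *: P e +
    ('X^(a - e) * qbinom k a e).[w] *: P e.+1)).
  apply: eq_bigr => e _; rewrite linearZ /= comulP -1?ltnS //.
  by rewrite scalerDr scalerA hornerM hornerXn mulrC.
rewrite big_split /= [RHS]big_ord_recl /= !qbinom0.
(* The zero term e = a + 1 is added so that, once e = 0 is split off, all sums run over [P e.+1]. *)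
rewrite [X in X + _ = _](_ : _ = \sum_(e < a.+2) (qbinom k a e).[w] *: P e).
  rewrite big_ord_recl /= qbinom0 -addrA -big_split; congr (_ + _).
  by apply: eq_bigr => e _; rewrite /= -scalerDl -hornerD -qbinomS // -ltnS.
by rewrite [RHS]big_ord_recr /= qbinom_gt // hornerC scale0r addr0.
Qed.

Lemma taft_counit a b : counit (x ^+ a * g ^+ b) = (a == 0%N)%:R.
Proof.
have counitX u c : counit u = 1 -> counit (u ^+ c : H) = 1.
  move=> u1; elim: c => [|c IHc]; first exact: counit1.
  by rewrite exprS counitM u1 IHc mul1r.
case: a => [|a]; first by rewrite mul1r counitX ?(taft_counitg taftH).
by rewrite exprS -mulrA counitM (taft_counitx taftH) mul0r.
Qed.

Lemma taft_conv (f h : 'End(H)) a b :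
  conv f h (x ^+ a * g ^+ b) =
  \sum_(e < a.+1) (qbinom k a e).[w] *:
    (f (x ^+ (a - e) * g ^+ (e + b)) * h (x ^+ e * g ^+ b)).
Proof.
rewrite convE comp_lfunE taft_comul linear_sum.
by apply: eq_bigr => e _; rewrite linearZ /= lmul_tensor_pure.
Qed.

(** Moving g^(e+b) past x^e yields w^(e^2) w^(be). The first power enters the recursion of [curlyp];
    the second combines with g^e into the e-th power of [w ^+ b *: g]. *)
Lemma taft_hpower m a b :
  hpower H m (x ^+ a * g ^+ b) =
  x ^+ a * g ^+ (m * b) * horner_alg (w ^+ b *: g) (curlyp w m a).
Proof.
elim: m a => [|m IHm] a.
  rewrite conv_unitE taft_counit; case: a => [|a] /=.
    by rewrite !mul1r -polyC1 horner_algC.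
  by rewrite !mulr0n -polyC0 horner_algC !scale0r mulr0.
rewrite hpowerSr taft_conv raddf_sum mulr_sumr.
apply: eq_bigr => e _; have le_ea : (e <= a)%N by rewrite -ltnS.
rewrite id_lfunE IHm /= linearZ /= rmorphM /= rmorphXn /= horner_algX.
rewrite mulr_algl -scalerAr -scalerA; congr (_ *: _).
rewrite -/(curlyp w m e) exprZn -scalerAl -scalerAr scalerA -exprM -exprD.
rewrite !mulrA -[_ * g ^+ (e + b) * x ^+ e]mulrA taft_comm.
rewrite -!scalerAr -!scalerAl !mulrA -exprD subnK //; congr (_ *: (_ * _)).
  by congr (_ ^+ _); lia.
by rewrite -!mulrA -!exprD; congr (_ * _ ^+ _); lia.
Qed.

Definition taft_sign a : k := (-1) ^+ a * w ^+ 'C(a, 2).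

(** For a > 0 the sum, read backwards, is [sum_qbinom_sign] at the index where its right side
    vanishes. *)
Lemma sum_qbinom_taft_sign a :
  \sum_(e < a.+1) (qbinom k a e).[w] * taft_sign (a - e) = (a == 0%N)%:R.
Proof.
rewrite (reindex_inj rev_ord_inj) /=.
case: a => [|a].
  by rewrite big_ord1 /taft_sign /= subnn qbinom0 hornerC !expr0 !mul1r.
have := congr1 (horner^~ w) (sum_qbinom_sign k a a.+1).
rewrite qbinom_gt // mulr0 horner0 horner_sum => sum0.
rewrite [RHS]mulr0n -[RHS]sum0; apply: eq_bigr => e _.
have le_ea : (e <= a.+1)%N by rewrite -ltnS.
rewrite subSS qbinom_sub // subKn // !hornerM hornerXn mulrC.
by rewrite -polyCN -polyC_exp hornerC.
Qed.

Hypotheses (N_gt1 : (1 < N)%N) (w_prim : N.-primitive_root w).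

Let N_gt0 : (0 < N)%N := ltnW N_gt1.

Let g_unit : g \is a GRing.unit.
Proof. by rewrite -(unitrX_pos _ N_gt0) gN unitr1. Qed.

Let w_neq0 : w != 0.
Proof.
by rewrite -unitfE -(unitrX_pos _ N_gt0) (prim_expr_order w_prim) unitr1.
Qed.

Lemma taft_commV a b : g ^- b * x ^+ a = w ^- (b * a) *: (x ^+ a * g ^- b).
Proof.
apply: (mulrI (unitrX b g_unit)); rewrite mulVKr ?unitrX //.
rewrite -scalerAr mulrA taft_comm -scalerAl scalerA mulVf ?expf_neq0 //.
by rewrite scale1r mulrK // unitrX.
Qed.

(** In the relation S * id = counit on x^a g^c, the term e = 0 is S(x^a g^c) g^c and the others
    involve S at lower powers of x. Strong induction on a thus determines S, once the closed form
    [T] is seen to satisfy the relation. *)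
Lemma taft_antipode a c :
  antipode (x ^+ a * g ^+ c) =
  (taft_sign a * w ^- (a * (a + c))) *: (x ^+ a * g ^- (a + c)).
Proof.
pose T b d := (taft_sign b * w ^- (b * (b + d))) *: (x ^+ b * g ^- (b + d)).
rewrite -/(T a c); elim/ltn_ind: a c => a IHa c.
have sumT : \sum_(e < a.+1) (qbinom k a e).[w] *:
    (T (a - e)%N (e + c)%N * (x ^+ e * g ^+ c)) = (a == 0%N)%:R%:A.
  (* All terms are multiples of the single vector x^a g^(-a), which reduces the relation to a scalar
     identity. *)
  transitivity (\sum_(e < a.+1) ((qbinom k a e).[w] * taft_sign (a - e)) *:
      (w ^- (a * (a + c)) *: (x ^+ a * g ^- a))).
    apply: eq_bigr => e _; have le_ea : (e <= a)%N by rewrite -ltnS.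
    have -> : x ^+ a * g ^- a = w ^+ ((a + c) * e) *:
        (x ^+ (a - e) * g ^- (a + c) * (x ^+ e * g ^+ c)).
      rewrite !mulrA -(mulrA (x ^+ _)) taft_commV -scalerAr -scalerAl scalerA.
      rewrite mulfV ?expf_neq0 // scale1r !mulrA -exprD subnK // -mulrA.
      by rewrite addnC exprD invrM ?unitrX // mulrVK ?unitrX.
    rewrite /T addnA subnK // -scalerAl !scalerA; congr (_ *: _).
    rewrite -!mulrA; congr (_ * (_ * _)).
    have -> : (a * (a + c) = (a - e) * (a + c) + (a + c) * e)%N by nia.
    by rewrite exprD invfM mulfVK ?expf_neq0.
  rewrite -scaler_suml sum_qbinom_taft_sign; case: eqP => [->|_].
    by rewrite !(mul0n, expr0, invr1, mulr1, scale1r).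
  by rewrite !scale0r.
have := taft_conv antipode \1%VF a c.
rewrite conv_antipodel taft_counit -sumT !big_ord_recl /=.
rewrite qbinom0 hornerC !scale1r subn0 add0n !mul1r id_lfunE.
under [in RHS]eq_bigr => e _.
  rewrite id_lfunE IHa; last by have := ltn_ord e; rewrite /bump /=; lia.
  over.
by move/addIr/(mulIr (unitrX c g_unit))/esym.
Qed.

(** * Spanning monomials, linear forms and Fourier inversion *)

Let xM : seq H := [seq x ^+ a * g ^+ b | a <- iota 0 N, b <- iota 0 N].

Let mem_xM a b : x ^+ a * g ^+ b \in <<xM>>%VS.
Proof.
have [le_Na | lt_aN] := leqP N a.
  by rewrite -(subnK le_Na) exprD xN mulr0 mul0r mem0v.
rewrite (divn_eq b N) exprD mulnC exprM gN expr1n mul1r.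
by apply/memv_span/allpairs_f; rewrite mem_iota //= ltn_mod.
Qed.

(** The span of the monomials contains 1 and is stable under left multiplication by the generators x
    and g. *)
Lemma taft_span h : h \in <<xM>>%VS.
Proof.
suff full : (fullv <= <<xM>>)%VS by apply: (subvP full); apply: memvf.
rewrite -(taft_gen taftH); apply: agenv_sub_modl.
  by rewrite -memvE; have := mem_xM 0 0; rewrite mulr1.
apply/prodvP => u v; move: u v.
have amullP u : (forall a b, u * (x ^+ a * g ^+ b) \in <<xM>>%VS) ->
    forall v, v \in <<xM>>%VS -> u * v \in <<xM>>%VS.
  move=> uP v; have -> : u * v = amull u v by rewrite lfunE.
  rewrite memv_preim; move: v.
  apply/subvP/span_subvP => _ /allpairsP[[a b] [_ _ ->]].
  by rewrite -memv_preim lfunE /= uP.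
move=> u v uP vP; have -> : u * v = amulr v u by rewrite lfunE.
rewrite memv_preim; move: u uP; apply/subvP/span_subvP => u.
rewrite !inE -memv_preim lfunE /= => /orP[] /eqP ->.
  by apply: amullP vP => a b; rewrite mulrA -exprS mem_xM.
apply: amullP vP => a b; rewrite mulrA.
have := taft_comm a 1; rewrite expr1 => ->.
by rewrite -scalerAl -mulrA -exprS memvZ // mem_xM.
Qed.

Lemma taft_ext (V : vectType k) (f h : 'Hom(H, V)) :
    (forall a b, (a < N)%N -> (b < N)%N ->
      f (x ^+ a * g ^+ b) = h (x ^+ a * g ^+ b)) ->
  f = h.
Proof.
move=> eqfh; apply/lfunP => v; apply/eqP; rewrite -subr_eq0.
have -> : f v - h v = (f - h)%R v by rewrite add_lfunE opp_lfunE.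
rewrite -memv_ker; move: v (taft_span v); apply/subvP/span_subvP.
move=> _ /allpairsP[[a b] [+ + ->]]; rewrite !mem_iota /= => aN bN.
by rewrite memv_ker add_lfunE opp_lfunE eqfh // subrr.
Qed.

(* The form is h |-> (coefficient of v_i in h v_0), on the module with basis
   v_0, ..., v_(N-1) where x maps v_j to v_(j+1) and v_(N-1) to 0, and
   g multiplies v_j by w ^+ j * z. *)
Lemma taft_form_exists (i : 'I_N) (z : k) : z ^+ N = 1 ->
  exists chi : 'Hom(H, k^o), forall a t, (a < N)%N ->
    chi (x ^+ a * g ^+ t) = (a == i)%:R * z ^+ t.
Proof.
(* N is written as a successor so that the matrices of this size form an [algType], as [taft_free]
   requires. *)
move=> zN; case: N w_prim xN gN i zN taftH N_gt1 => // n wn xn gn i zn Hn _.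
pose X : 'M[k]_n.+1 := \matrix_(i, j) (i == j.+1 :> nat)%:R.
pose D (c : 'I_n.+1 -> k) : 'M[k]_n.+1 := diag_mx (\row_j c j).
pose G := D (fun j => w ^+ j * z).
have XE e (r j : 'I_n.+1) : (X ^+ e) r j = (r == (j + e)%N :> nat)%:R.
  elim: e r => [|e IHe] r; first by rewrite mxE addn0.
  rewrite exprS mxE; case: (ltnP (j + e)%N n.+1) => [lt_en | le_ne].
    rewrite (bigD1 (Ordinal lt_en)) //= IHe eqxx mulr1 big1 ?addr0 => [|l].
      by rewrite mxE addnS.
    by rewrite -val_eqE /= IHe => /negbTE ->; rewrite mulr0.
  rewrite big1 => [|l _]; last first.
    by rewrite IHe ltn_eqF ?mulr0 // (leq_trans (ltn_ord l)).
  by rewrite ltn_eqF // addnS ltnS (leq_trans _ le_ne) // ltnW.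
have DE e : G ^+ e = D (fun j => (w ^+ j * z) ^+ e).
  elim: e => [|e IHe].
    by apply/matrixP => r j; rewrite !mxE; case: eqP; rewrite ?expr0.
  rewrite exprS IHe; apply/matrixP => r j.
  by rewrite /G /D -!mulmxE mul_diag_mx !mxE exprS mulrnAr.
have [|f [fx fg]] := taft_free Hn (A := 'M[k]_n.+1) (x' := X) (g' := G).
  split.
  - by apply/matrixP => r j; rewrite XE mxE ltn_eqF // ltn_addl.
  - rewrite DE; apply/matrixP => r j; rewrite !mxE exprMn zn mulr1 -exprM.
    by rewrite mulnC exprM (prim_expr_order wn) expr1n.
  apply/matrixP => r j.
  rewrite /G /D -!mulmxE mul_diag_mx mul_mx_diag !mxE; case: eqP => [->|_].
    by rewrite mulr1 mul1r exprS mulrA.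
  by rewrite mulr0 mul0r mulr0.
exists (linfun (fun h => f h i ord0 : k^o)) => a t lt_an.
rewrite linfunE => [|c u v]; last by rewrite linearP !mxE.
rewrite rmorphM !rmorphXn /= fx fg DE -mulmxE mul_mx_diag !mxE XE add0n eq_sym.
by rewrite expr0 mul1r.
Qed.

Let gV t : g ^- t = g ^+ (N.-1 * t).
Proof.
rewrite exprM -exprVn; congr (_ ^+ t).
by apply: (mulrI g_unit); rewrite mulrV // -exprS prednK // gN.
Qed.

Hypothesis N_neq0 : N%:R != 0 :> k.

(* An eigenvector of right multiplication by g, of eigenvalue
   w ^- (i.1 + i.2). *)
Definition taft_eigen (i : 'I_N * 'I_N) : H :=
  N%:R^-1 *: \sum_(b < N) w ^+ ((i.1 + i.2) * b) *: (x ^+ i.1 * g ^+ b).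

(** On x^a g^t only the indices (a, s) contribute, and Fourier inversion over s mod N recovers
    g^t. *)
Lemma taft_expansion (chi : 'I_N * 'I_N -> 'Hom(H, k^o)) :
    (forall i a t, (a < N)%N ->
      chi i (x ^+ a * g ^+ t) = (a == i.1)%:R * w ^- (i.1 + i.2) ^+ t) ->
  forall h, h = \sum_i (chi i h : k) *: taft_eigen i.
Proof.
move=> chiE h.
pose F : 'End(H) := linfun (fun h => \sum_i (chi i h : k) *: taft_eigen i).
have FE v : F v = \sum_i (chi i v : k) *: taft_eigen i.
  rewrite linfunE // => c u u'; rewrite scaler_sumr -big_split.
  apply: eq_bigr => i _.
  by move: (taft_eigen i) => e; rewrite linearP /= scalerDl scalerA.
rewrite -FE -[LHS](id_lfunE h); congr (fun_of_lfun _ h).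
apply: taft_ext => a t lt_aN lt_tN; rewrite id_lfunE FE.
pose K (i s : 'I_N) : H :=
  (a == i)%:R *: (w ^- (i + s) ^+ t *: taft_eigen (i, s)).
rewrite (eq_bigr (fun i => K i.1 i.2)) => [|[i s] _]; last first.
  by rewrite chiE // /K scalerA.
rewrite -(pair_bigA _ K) /K /= (bigD1 (Ordinal lt_aN)) //=.
rewrite [X in _ + X]big1 ?addr0 => [|i]; last first.
  rewrite -val_eqE /= eq_sym => /negbTE ->.
  by apply: big1 => s _; rewrite scale0r.
pose C b := \sum_(s < N) N%:R^-1 * (w ^- (a + s) ^+ t * w ^+ ((a + s) * b)).
transitivity (\sum_(b < N) C b *: (x ^+ a * g ^+ b)); last first.
  under [RHS]eq_bigr do rewrite eqxx scale1r /taft_eigen 2!scaler_sumr /=.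
  rewrite exchange_big; apply: eq_bigr => b _; rewrite scaler_suml.
  by apply: eq_bigr => s _; rewrite !scalerA mulrCA mulrA.
suff CE (b : 'I_N) : C b = (b == Ordinal lt_tN)%:R.
  under eq_bigr do rewrite CE.
  rewrite (bigD1 (Ordinal lt_tN)) //= eqxx scale1r big1 ?addr0 // => b.
  by move=> /negbTE ->; rewrite scale0r.
have wMN e : w ^+ (e * N) = 1.
  by rewrite mulnC exprM (prim_expr_order w_prim) expr1n.
rewrite /C -mulr_sumr; apply: (mulfI N_neq0); rewrite mulVKf //.
(* This is b - t mod N as a natural number; it lies strictly between 0 and 2N, so N divides it only
   if b = t. *)
pose r := (b + (N - t))%N.
transitivity (w ^+ (a * r) * \sum_(s < N) w ^+ (s * r)).
  rewrite mulr_sumr; apply: eq_bigr => s _; rewrite -exprD -mulnDl.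
  rewrite mulnDr [RHS]exprD [RHS]mulrC; congr (_ * _).
  rewrite -exprVn -exprM exprVn.
  apply: (mulIf (expf_neq0 ((a + s) * t) w_neq0)).
  by rewrite mulVf ?expf_neq0 // -exprD -mulnDr subnK ?(ltnW lt_tN) // wMN.
rewrite (sum_prim_root_exp _ w_prim) mulrCA /r.
have -> : (N %| b + (N - t))%N = (b == Ordinal lt_tN).
  have lt_bN := ltn_ord b; rewrite -val_eqE /=.
  by apply/dvdnP/eqP => [[[|[|q]]] | ->]; [nia.. | exists 1%N; lia].
case: eqP => [-> /= | _]; last by rewrite !mulr0.
by rewrite subnKC ?(ltnW lt_tN) // wMN mul1r.
Qed.

(** * The indicator as a double sum over powers of w *)

Lemma taft_nu m :
  nu H m.+1 = N%:R^-1 * \sum_(b < N) \sum_(s < N)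
    w ^+ (s * (m.+1 * b)) * (curlyp w m.+1 N.-1).[w ^+ (b + s)].
Proof.
have chiP (i : 'I_N * 'I_N) : exists chi : 'Hom(H, k^o),
    forall a t, (a < N)%N ->
      chi (x ^+ a * g ^+ t) = (a == i.1)%:R * w ^- (i.1 + i.2) ^+ t.
  apply: taft_form_exists.
  by rewrite -exprVn exprAC exprVn (prim_expr_order w_prim) invr1 expr1n.
have [chi chiE] := fin_all_exists chiP.
rewrite /nu (lftrace_expansion _ (taft_expansion chiE)).
(* The eigenvalue is indexed by i.1 + i.2 for this step: the form gives w^((i.1 + i.2)(i.1 + c)),
   whose i.1 part cancels the scalar w^(-i.1 (i.1 + c)) of the antipode. *)
have chiS (i : 'I_N * 'I_N) c : chi i (antipode (x ^+ i.1 * g ^+ c)) =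
    taft_sign i.1 * w ^+ (i.2 * i.1) * w ^+ i.2 ^+ c.
  rewrite taft_antipode linearZ /= gV chiE ?ltn_ord //.
  rewrite eqxx mul1r -[_ *: _]/(_ * _) -!(mulrA (taft_sign _)); congr (_ * _).
  have wVV : w^-1 ^+ N.-1 = w.
    rewrite exprVn; apply: (mulIf (expf_neq0 N.-1 w_neq0)).
    by rewrite mulVf ?expf_neq0 // -exprS prednK // (prim_expr_order w_prim).
  rewrite -[w ^- (i.1 + i.2)]exprVn -exprM mulnCA [w^-1 ^+ _]exprM wVV.
  apply: (mulfI (expf_neq0 (i.1 * (i.1 + c)) w_neq0)).
  by rewrite mulVKf ?expf_neq0 // -exprM -!exprD; congr (_ ^+ _); lia.
(* By [chiS] the exponent c enters only through w^(i.2 c), so g acts as w^(i.2) and [p] is evaluated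
   at w^(b + i.2). *)
have chiSP (i : 'I_N * 'I_N) c b (p : {poly k}) :
    chi i (antipode (x ^+ i.1 * g ^+ c * horner_alg (w ^+ b *: g) p)) =
    taft_sign i.1 * w ^+ (i.2 * i.1) * w ^+ i.2 ^+ c * p.[w ^+ (b + i.2)].
  rewrite -[p in LHS]coefK poly_def rmorph_sum mulr_sumr !linear_sum /=.
  rewrite horner_coef mulr_sumr; apply: eq_bigr => e _.
  rewrite linearZ /= rmorphXn /= horner_algX exprZn mulr_algl -!scalerAr.
  rewrite -(mulrA (x ^+ _)) -exprD.
  rewrite !linearZ /= chiS -!exprM -[_ *: (_ *: _)]/(_ * (_ * _)).
  rewrite mulnDr mulnDl !exprD; ring.
(* For i = (a, s), the product w^((a+s)b) w^(sa) w^(smb) is regrouped as w^(s(m+1)b) w^((b+s)a), and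
   [taft_sign a] becomes binom(N-1, a)_w w^(a^2), as in the recursion of [curlyp] at N-1. *)
transitivity (\sum_(i : 'I_N * 'I_N) N%:R^-1 * \sum_(b < N)
    w ^+ (i.2 * (m.+1 * b)) * ((qbinom k N.-1 i.1).[w] * w ^+ (i.1 ^ 2) *
      (w ^+ (b + i.2) ^+ i.1 * (curlyp w m i.1).[w ^+ (b + i.2)]))).
  apply: eq_bigr => i _; rewrite comp_lfunE /taft_eigen !linearZ /=.
  congr (_ * _); rewrite !linear_sum; apply: eq_bigr => b _.
  rewrite !linearZ /= taft_hpower chiSP -[_ *: _]/(_ * _).
  rewrite (horner_qbinom_pred w_prim) // /taft_sign -!exprM.
  by rewrite !mulnDl mulSn mulnDr !exprD [(b * i.1)%N]mulnC; ring.
rewrite -mulr_sumr; congr (_ * _).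
rewrite exchange_big; apply: eq_bigr => b _.
rewrite -(pair_bigA _ (fun a s : 'I_N => w ^+ (s * (m.+1 * b)) *
  ((qbinom k N.-1 a).[w] * w ^+ (a ^ 2) *
    (w ^+ (b + s) ^+ a * (curlyp w m a).[w ^+ (b + s)])))) /=.
rewrite exchange_big; apply: eq_bigr => s _; rewrite -mulr_sumr; congr (_ * _).
rewrite horner_sum prednK //; apply: eq_bigr => a _.
by rewrite hornerZ hornerM hornerXn.
Qed.
End TaftAlgebra.

Theorem theorem6p4 (k : closedFieldType) (char0 : [pchar k] =i pred0)
    (N : nat) (w : k) (N_gt1 : (1 < N)%N) (w_prim : N.-primitive_root w)
    (H : hopfAlgType k) (x g : H) (taftH : is_taft N w x g)
    (n : nat) (n_gt0 : (1 <= n)%N)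
    (nc : int) (ncP : (nc * n = gcdn N n %[mod N])%Z) :
  let d := gcdn N n in
  nu H n = d%:R * \sum_(i \in [set: nat]%classic)
    (qcurly k N.-1 (d * i) n.-1).[w] * w ^ (- (nc * (d * i ^ 2)%N%:Z)).
Proof.
move=> d; have N_neq0 : N%:R != 0 :> k.
  by rewrite ((pcharf0P k).1 char0) -lt0n ltnW.
case: n n_gt0 ncP @d => // m _ ncP d.
rewrite (taft_nu taftH N_gt1 w_prim N_neq0).
rewrite (sum_horner_prim_root char0 w_prim ncP).
by congr (_ * _); apply: eq_fsbigr => i _; rewrite coef_curlyp.
Qed.
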